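(* Let $u$ and $v$ be nonadjacent (distinct) vertices of a graph $G$. Then $\gamma(G) \leq \gamma(G_{u,v,4}) \leq \gamma(G)+2$. Moreover, the following assertions are valid. (E) $\gamma(G_{u,v,4}) = \gamma(G)+2$ if and only if $\gamma(G_{u,v,1}) = \gamma(G)+1$. (F) If $\gamma(G_{u,v,1}) = \gamma(G)$ and $\gamma(G_{u,v,i}) = \gamma(G)+1$ for some $i \in \{2,3\}$, then $\gamma(G_{u,v,4}) = \gamma(G)+1$. (G) Let $\gamma(G_{u,v,3}) = \gamma(G)$. Then $\gamma(G_{u,v,4}) \leq \gamma(G)+1$, and equality holds if and only if $\gamma(G-\{u,v\}) \geq \gamma(G)-1$. (H) $\gamma(G_{u,v,4}) = \gamma(G)$ if and only if $\gamma(G-\{u,v\}) = \gamma(G)-2$.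
   Context: Graphs are finite and simple. $\gamma(H)$ denotes the domination number of a graph $H$, with $\gamma=0$ for the graph with no vertices. For distinct vertices $u,v$ of $G$ and an integer $k\geq 1$, $G_{u,v,k}$ denotes the graph obtained from the disjoint union of $G$ and a path $x_0,x_1,\dots,x_{k+1}$ by identifying $u$ with $x_0$ and $v$ with $x_{k+1}$ (so $k$ new vertices $x_1,\dots,x_k$ are added). *)

(* Defs.v *)
From mathcomp Require Import all_boot.

Set Implicit Arguments.
Unset Strict Implicit.
Unset Printing Implicit Defensive.

Record sgraph := SGraph {
  vertex :> finType;
  adj : rel vertex;
  adj_sym : symmetric adj;
  adj_irrefl : irreflexive adj }.

Definition dominating (G : sgraph) (D : {set G}) : bool :=
  [forall x, (x \in D) || [exists y in D, adj y x]].

Lemma dominating_setT (G : sgraph) : dominating [set: G].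
Proof. by apply/forallP => x; rewrite inE. Qed.

(* The minimum is over a nonempty family by dominating_setT; for the graph
   with no vertices it is #|set0| = 0. *)
Definition gamma (G : sgraph) : nat :=
  #|[arg min_(D < [set: G] | dominating D) #|D| ]|.

Section AttachPath.
Variables (G : sgraph) (u v : G) (k : nat).

(* The new vertex x_j of the path u = x_0, x_1, ..., x_k, x_(k+1) = v is
   inr i with val i = j.-1.  The construction is meant for 0 < k only: for
   k = 0 it gives back G, without an edge between u and v. *)
Definition attach_adj (a b : G + 'I_k) : bool :=
  match a, b with
  | inl x, inl y => adj x y
  | inl x, inr i | inr i, inl x =>
      (x == u) && (i == 0 :> nat) || (x == v) && (i.+1 == k)
  | inr i, inr j => (i.+1 == j) || (j.+1 == i)
  end.

Lemma attach_adj_sym : symmetric attach_adj.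
Proof. by move=> [x|i] [y|j] //=; rewrite ?(adj_sym x) // orbC. Qed.

Lemma attach_adj_irrefl : irreflexive attach_adj.
Proof. by move=> [x|i] /=; rewrite ?adj_irrefl // orbb gtn_eqF. Qed.

Definition attach_path : sgraph := SGraph attach_adj_sym attach_adj_irrefl.

End AttachPath.

Section DeleteVertices.
Variables (G : sgraph) (S : {set G}).

Definition delete_adj (a b : {x : G | x \notin S}) : bool :=
  adj (val a) (val b).

Lemma delete_adj_sym : symmetric delete_adj.
Proof. by move=> a b; apply: adj_sym. Qed.

Lemma delete_adj_irrefl : irreflexive delete_adj.
Proof. by move=> a; apply: adj_irrefl. Qed.

Definition delete_vertices : sgraph := SGraph delete_adj_sym delete_adj_irrefl.

End DeleteVertices.

(* Main.v *)
(* A dominating set of G_{u,v,4} restricts to G either as a dominating set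
   containing u or v (one new vertex then suffices) or, when it has at least
   two new vertices, as a set dominating G - {u,v} (x_1 and x_4 then suffice).
   The same two possibilities govern G_{u,v,1}, with one new vertex fewer, so
   gamma(G_{u,v,4}) = gamma(G_{u,v,1}) + 1.  The other facts come from
   completing a set dominating G - {u,v} by u, by v or by both. *)
Require Import Defs.
From mathcomp Require Import all_boot zify.

Set Implicit Arguments.
Unset Strict Implicit.

(** * Domination numbers as bounds witnessed by sets *)

Section Domination.
Variable G : sgraph.
Implicit Types (D E : {set G}) (x y : G).

Definition dominated D x : bool := (x \in D) || [exists y in D, adj y x].

Lemma dominatingP D : reflect (forall x, dominated D x) (dominating D).
Proof. exact: forallP. Qed.

Lemma dominated_mem D x : x \in D -> dominated D x.
Proof. by rewrite /dominated => ->. Qed.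

Lemma dominatedS D E x : D \subset E -> dominated D x -> dominated E x.
Proof.
move=> /subsetP sDE /orP[/sDE/dominated_mem // | /exists_inP[y /sDE Ey axy]].
by apply/orP; right; apply/exists_inP; exists y.
Qed.

(** With [m] arbitrary, domination numbers of different graphs can be compared by exchanging
    witnesses. *)
Lemma gamma_leP m :
  gamma G <= m <-> exists2 D : {set G}, dominating D & #|D| <= m.
Proof.
rewrite /gamma; case: arg_minnP => [|D domD minD]; first exact: dominating_setT.
by split=> [leDm | [E /minD leDE]]; [exists D | apply: leq_trans].
Qed.

Lemma gamma_le_card D : dominating D -> gamma G <= #|D|.
Proof. by move=> domD; apply/gamma_leP; exists D. Qed.

End Domination.

(** Transport along [val] replaces sets of the subtype by subsets of [G] that avoid [S]. *)
Lemma gamma_delete_leP (G : sgraph) (S : {set G}) m :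
  gamma (delete_vertices S) <= m <->
  exists D : {set G}, [/\ [disjoint D & S], #|D| <= m
              & forall x, x \notin S -> dominated D x].
Proof.
rewrite gamma_leP; split=> [[D /forallP domD leDm] | [D [disDS leDm domD]]].
  exists (val @: D); split.
  - apply/pred0P => x /=; apply/andP => -[/imsetP[z _ ->]].
    by apply/negP; exact: (valP z).
  - by rewrite card_imset //; apply: val_inj.
  - move=> x xS; have /orP[Dx | /exists_inP[y Dy ayx]] := domD (Sub x xS).
      by apply/dominated_mem/imsetP; exists (Sub x xS).
    apply/orP; right; apply/exists_inP; exists (val y) => //.
    by apply: imset_f.
exists (val @^-1: D).
  apply/forallP => x; have /orP[Dx | /exists_inP[y Dy ayx]] := domD _ (valP x).
    by rewrite inE Dx.
  apply/orP; right; apply/exists_inP.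
  by exists (Sub y (negbT (disjointFr disDS Dy))); rewrite ?inE.
apply: leq_trans leDm; rewrite -(card_imset _ val_inj).
by apply/subset_leq_card/subsetP => _ /imsetP[z + ->]; rewrite inE.
Qed.

(** * Dominating sets of a graph with an attached path *)

Section AttachedPath.
Variables (G : sgraph) (u v : G).

(* p i says that the new vertex x_(i+1) is chosen. *)
Lemma gamma_attach_leP k m :
  gamma (attach_path u v k.+1) <= m <->
  exists (D : {set G}) (p : pred nat),
    [/\ #|D| + count p (iota 0 k.+1) <= m,
        forall x, [|| dominated D x, (x == u) && p 0 | (x == v) && p k]
      & forall i, i <= k ->
          [|| p i, (i == 0) && (u \in D), (i == k) && (v \in D),
              (0 < i) && p i.-1 | (i < k) && p i.+1]].
Proof.
have cardE (A : {set G + 'I_k.+1}) (D : {set G}) (p : pred nat) :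
    (forall x, (inl x \in A) = (x \in D)) -> (forall i, (inr i \in A) = p i) ->
  #|A| = #|D| + count p (iota 0 k.+1).
  move=> AD Ap; rewrite -!sum1_card big_sumType /=; congr (_ + _).
    exact: eq_bigl.
  rewrite (eq_bigl (fun i : 'I_k.+1 => p i)) // -(big_mkord p (fun=> 1)).
  by rewrite sum1_count /index_iota subn0.
rewrite gamma_leP; split=> [[A /dominatingP domA leAm] | [D [p [leDm domG domP]]]].
  pose D := [set x | inl x \in A].
  (* Out of range, [inord] falls back to index 0; the guard makes [p] false there. *)
  pose p i := (i <= k) && (inr (inord i) \in A).
  have pE (i : 'I_k.+1) : p i = (inr i \in A).
    by rewrite /p -ltnS ltn_ord inord_val.
  exists D, p; split.
  - by rewrite -(@cardE A D p) // => x; rewrite inE.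
  - move=> x; have /orP[Ax | /exists_inP[[y|i] Ay]] := domA (inl x).
    + by rewrite dominated_mem ?inE.
    + move=> ayx; apply/orP; left; apply/orP; right; apply/exists_inP.
      by exists y; rewrite ?inE.
    + rewrite -pE in Ay; case/orP=> /andP[-> /eqP ei].
        by rewrite -ei Ay orbT.
      by case: ei => <-; rewrite Ay !orbT.
  - move=> i le_ik; have := domA (inr (inord i)).
    case/orP=> [Ai | /exists_inP[[y|j] Ay]]; first by rewrite /p le_ik Ai.
      rewrite /= inordK //; case/orP=> /andP[/eqP ey ei]; subst y.
        by rewrite ei inE Ay orbT.
      by rewrite eqSS in ei; rewrite ei [v \in D]inE Ay !orbT.
    rewrite -pE in Ay; have := ltn_ord j; rewrite /= inordK // ltnS => le_jk.
    case/orP=> /eqP ej.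
      by rewrite -ej /= Ay !orbT.
    by rewrite -ej in Ay le_jk; rewrite le_jk Ay !orbT.
pose A : {set attach_path u v k.+1} :=
  [set z : G + 'I_k.+1 | match z with inl x => x \in D | inr i => p i end].
exists A; last by rewrite (@cardE A D p) // => x; rewrite inE.
apply/dominatingP => -[x | i]; rewrite /dominated inE.
  case/or3P: (domG x) => [/orP[-> //|/exists_inP[y Dy ayx]]| |].
  - by apply/orP; right; apply/exists_inP; exists (inl y); rewrite ?inE.
  - case/andP=> xu p0; apply/orP; right; apply/exists_inP.
    by exists (inr ord0); rewrite ?inE //= xu.
  - case/andP=> xv pk; apply/orP; right; apply/exists_inP.
    by exists (inr ord_max); rewrite ?inE //= xv eqxx orbT.
have le_ik : i <= k by rewrite -ltnS.
have /or4P[-> // | | | /orP[]] := domP i le_ik; case/andP=> Hi Hp;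
  apply/orP; right; apply/exists_inP.
- by exists (inl u); rewrite ?inE //= eqxx Hi.
- by exists (inl v); rewrite ?inE //= eqxx eqSS Hi orbT.
- have lt_i : i.-1 < k.+1 by lia.
  by exists (inr (Ordinal lt_i)); rewrite ?inE //= prednK // eqxx.
- have lt_i : i.+1 < k.+1 by lia.
  by exists (inr (Ordinal lt_i)); rewrite ?inE //= eqxx orbT.
Qed.

(** * Attaching one or four new vertices *)

Definition dominates_outside (D : {set G}) : Prop :=
  forall x, x \notin [set u; v] -> dominated D x.

(** The cases are those of the single new vertex of [attach_path u v 1]: not chosen, it needs [u] or
    [v] in [D]; chosen, it dominates both of them and costs one, hence the strict bound. *)
Definition path1_dominable (m : nat) : Prop :=
  (exists D : {set G}, [/\ dominating D, (u \in D) || (v \in D) & #|D| <= m]) \/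
  (exists D : {set G}, dominates_outside D /\ #|D| < m).

(** Here [b] and [c] stand for the choice of the first and last new vertices, whose only possible
    neighbours in [G] are [u] and [v]. *)
Lemma dominates_outsideP (D : {set G}) (b c : bool) :
  (forall x, [|| dominated D x, (x == u) && b | (x == v) && c]) ->
  dominates_outside D.
Proof.
move=> domD x; rewrite !inE => /norP[/negPf xu /negPf xv].
by have := domD x; rewrite xu xv orbF.
Qed.

Lemma dominates_outside_path (D : {set G}) (x : G) :
  dominates_outside D -> [|| dominated D x, (x == u) && true | (x == v) && true].
Proof.
move=> domD; rewrite !andbT; have := domD x; rewrite !inE.
by case: (x == u); case: (x == v); rewrite ?orbT // => ->.
Qed.

Lemma gamma_attach1_leP m :
  gamma (attach_path u v 1) <= m <-> path1_dominable m.
Proof.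
rewrite gamma_attach_leP; split.
  case=> D [p [/= leDm domG domP]].
  have := domP 0 isT; case p0: (p 0) in leDm domG *.
    move=> _; right; exists D; split; last lia.
    exact: dominates_outsideP domG.
  rewrite /= orbF => uvD; left; exists D; split=> //; last lia.
  by apply/dominatingP => x; have := domG x; rewrite !andbF !orbF.
case=> [[D [/dominatingP domD uvD leDm]] | [D [domD ltDm]]].
  exists D, xpred0; rewrite /= !addn0; split=> // [x|[]//=]; first by rewrite domD.
  by rewrite orbF.
exists D, xpredT; rewrite /= addn0 addn1; split=> // x.
exact: dominates_outside_path.
Qed.

Lemma gamma_attach4_leP m :
  gamma (attach_path u v 4) <= m.+1 <-> path1_dominable m.
Proof.
rewrite gamma_attach_leP; split.
  case=> D [p [/= leDm domG domP]].
  have outD := dominates_outsideP domG.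
  have [lt1|le1] := ltnP 1 (p 0 + p 1 + p 2 + p 3).
    by right; exists D; split=> //; lia.
  have domD (p03 : (p 0 = false) /\ (p 3 = false)) : dominating D.
    by apply/dominatingP => x; have := domG x; rewrite p03.1 p03.2 !andbF !orbF.
  left; exists D.
  (* With at most one new vertex chosen, the domination of the inner indices 1 and 2 forces it to be
     one of them. Index 1 leaves the last vertex to [v], index 2 leaves the first to [u]. *)
  have := domP 0 isT; have := domP 1 isT; have := domP 2 isT; have := domP 3 isT.
  move: le1 leDm domD; rewrite /=.
  case: (p 0) => /=; case: (p 1) => /=; case: (p 2) => /=; case: (p 3) => //= _ + domD;
    rewrite ?addn0 ?addn1 ?add0n => leDm; rewrite ?orbF => //.
  - by move=> -> _ _ _; rewrite orbT; split=> //; apply: domD.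
  - by move=> _ _ _ /= ->; split=> //; apply: domD.
case=> [[D [/dominatingP domD uvD leDm]] | [D [domD ltDm]]].
  (* The chosen inner vertex is the one not adjacent to the end that [D] already dominates through
     [u] or [v]. *)
  exists D, (pred1 (if u \in D then 2 else 1)).
  split=> [|x|].
  - case: ifP => _ /=; lia.
  - by rewrite domD.
  - by case: (u \in D) uvD => [_|/= ->] [|[|[|[|i]]]] //=; rewrite orbT.
exists D, (pred2 0 3); split=> [|x|]; first by rewrite /=; lia.
  exact: dominates_outside_path.
by move=> [|[|[|[|i]]]].
Qed.

Lemma gamma_attach4E :
  gamma (attach_path u v 4) = (gamma (attach_path u v 1)).+1.
Proof.
apply/eqP; rewrite eqn_leq; apply/andP; split.
  by apply/gamma_attach4_leP/gamma_attach1_leP.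
case E: (gamma (attach_path u v 4)) => [|n].
  (* The value 0 is not of the form [m.+1]. It is excluded because the new vertex of index 1 has
     only new neighbours, so some new vertex is chosen. *)
  have /gamma_attach_leP[D [p []]] : gamma (attach_path u v 4) <= 0 by rewrite E.
  rewrite /= => leD _ /(_ 1 isT) /=.
  by case: (p 0) leD; case: (p 1); case: (p 2) => //=; lia.
by rewrite ltnS; apply/gamma_attach1_leP/gamma_attach4_leP; rewrite E.
Qed.

(** * Completing a set that dominates all but [u] and [v] *)

Lemma gamma_le_outsideU (D E : {set G}) :
  dominates_outside D -> u \in D :|: E -> v \in D :|: E ->
  gamma G <= #|D| + #|E|.
Proof.
move=> domD uDE vDE; apply: leq_trans (leq_card_setU _ _).
apply/gamma_le_card/dominatingP => x.
have [|/domD] := boolP (x \in [set u; v]).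
  by rewrite !inE => /orP[] /eqP ->; apply: dominated_mem.
by apply: dominatedS; apply: subsetUl.
Qed.

Lemma gamma_le_outside (D : {set G}) :
  dominates_outside D -> gamma G <= #|D|.+2.
Proof.
move=> domD; rewrite -addn2; have := @gamma_le_outsideU D [set u; v] domD.
rewrite !inE !eqxx !orbT => /(_ isT isT) /leq_trans; apply.
by rewrite leq_add2l cards2; case: (u != v).
Qed.

Lemma gamma_le_outside_mem (D : {set G}) :
  dominates_outside D -> (u \in D) || (v \in D) -> gamma G <= #|D|.+1.
Proof.
move=> domD; rewrite -addn1; case/orP=> [uD | vD].
  by rewrite -(cards1 v); apply: gamma_le_outsideU; rewrite // !inE ?uD ?eqxx ?orbT.
by rewrite -(cards1 u); apply: gamma_le_outsideU; rewrite // !inE ?vD ?eqxx ?orbT.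
Qed.

Lemma gamma_attach1_leS : gamma (attach_path u v 1) <= (gamma G).+1.
Proof.
have /gamma_leP[D /dominatingP domD leD] := leqnn (gamma G).
by apply/gamma_attach1_leP; right; exists D; split=> // x _; apply: domD.
Qed.

Lemma gamma_leS_attach1 : gamma G <= (gamma (attach_path u v 1)).+1.
Proof.
case/gamma_attach1_leP: (leqnn (gamma (attach_path u v 1))).
  by case=> D [/gamma_le_card leG _ /(leq_trans leG)/leqW].
by case=> D [/gamma_le_outside leG ltD]; apply: leq_trans leG _.
Qed.

Lemma gamma_le_delete2 : gamma G <= (gamma (delete_vertices [set u; v])).+2.
Proof.
have /gamma_delete_leP[D [_ leD /gamma_le_outside leG]] :=
  leqnn (gamma (delete_vertices [set u; v])).
exact: leq_trans leG _.
Qed.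

(** This is the case of equality in [gamma_leS_attach1] and [gamma_le_delete2], which becomes (H)
    through [gamma_attach4E]. *)
Lemma gamma_attach1_pred :
  (gamma (attach_path u v 1)).+1 = gamma G <->
  (gamma (delete_vertices [set u; v])).+2 = gamma G.
Proof.
have leG1 := gamma_leS_attach1; have leGd := gamma_le_delete2; split=> eqG.
  case/gamma_attach1_leP: (leqnn (gamma (attach_path u v 1))) => -[D].
    by case=> /gamma_le_card leGD _; lia.
  case=> domD ltD; apply/eqP; rewrite eqn_leq leGd andbT -eqG ltnS.
  apply: leq_trans (ltD); rewrite ltnS; apply/gamma_delete_leP; exists D; split=> //.
  (* If [D] met [{u, v}], adding the other vertex would dominate [G] with fewer than [gamma G]
     vertices; so [D] lives in the graph with [u] and [v] deleted. *)
  have [/(gamma_le_outside_mem domD)|/norP[uD vD]] := boolP ((u \in D) || (v \in D)).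
    lia.
  rewrite disjoint_sym; apply/pred0P => x; rewrite !inE.
  have [-> | _] := eqVneq x u; first exact: negbTE.
  by have [-> | //] := eqVneq x v; apply: negbTE.
suff : gamma (attach_path u v 1) <= (gamma (delete_vertices [set u; v])).+1 by lia.
have /gamma_delete_leP[D [_ leD domD]] :=
  leqnn (gamma (delete_vertices [set u; v])).
by apply/gamma_attach1_leP; right; exists D.
Qed.

(** The middle new vertex has only new neighbours, so some new vertex is chosen and fewer than
    [gamma G] vertices lie in [G]; the single new vertex of [attach_path u v 1] completes them. *)
Lemma gamma_attach1_le_attach3 :
  gamma (attach_path u v 3) <= gamma G -> gamma (attach_path u v 1) <= gamma G.
Proof.
case/gamma_attach_leP=> D [p [/= leD domG domP]]; apply/gamma_attach1_leP.
have outD := dominates_outsideP domG.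
right; exists D; split=> //; have := domP 1 isT.
by move: leD; rewrite /=; case: (p 0); case: (p 1); case: (p 2) => //=; lia.
Qed.

End AttachedPath.

Unset Implicit Arguments.
Set Strict Implicit.

Theorem theorem20 (G : sgraph) (u v : G) (huv : u != v) (hadj : ~~ adj u v) :
  (gamma G <= gamma (attach_path u v 4) <= gamma G + 2) /\
  (* (E) *)
  (gamma (attach_path u v 4) = gamma G + 2 <->
   gamma (attach_path u v 1) = gamma G + 1) /\
  (* (F) *)
  (gamma (attach_path u v 1) = gamma G ->
   (exists2 i, i \in [:: 2; 3] & gamma (attach_path u v i) = gamma G + 1) ->
   gamma (attach_path u v 4) = gamma G + 1) /\
  (* (G) *)
  (gamma (attach_path u v 3) = gamma G ->
   gamma (attach_path u v 4) <= gamma G + 1 /\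
   (gamma (attach_path u v 4) = gamma G + 1 <->
    gamma G <= gamma (delete_vertices [set u; v]) + 1)) /\
  (* (H) *)
  (gamma (attach_path u v 4) = gamma G <->
   gamma (delete_vertices [set u; v]) + 2 = gamma G).
Proof.
have leG1 := @gamma_leS_attach1 G u v; have le1G := @gamma_attach1_leS G u v.
have leGd := @gamma_le_delete2 G u v.
have [d_of_1 one_of_d] := @gamma_attach1_pred G u v.
have le13 := @gamma_attach1_le_attach3 G u v.
rewrite (gamma_attach4E u v); split; first by lia.
split; first by lia.
split; first by move=> eq1 _; lia.
(* In (G), [le13] gives the upper bound. Equality fails exactly when [gamma (attach_path u v 1)] is
   one less than [gamma G], which [d_of_1] and [one_of_d] translate to the deleted graph. *)
by split=> [eq3|]; lia.
Qed.
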